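(* Let $c<0.16$ and $q=q(n)=cn^{2/3}$. Then for all sufficiently large $n$ there is a winning strategy for Maker in the Maker-Breaker $C_4$-game on $K_n$ with Breaker bias $q$.
   Context: The Maker-Breaker $C_4$-game on the complete graph $K_n$ with bias $q$: two players, Maker and Breaker, alternately claim previously unclaimed edges of $K_n$; in each round Maker claims one edge and Breaker is allowed to claim up to $q$ edges. Maker wins if he claims all edges of a copy of $C_4$ (the cycle on four vertices) in $K_n$; otherwise Breaker wins. *)

(* Defs.v *)
From mathcomp Require Import all_boot.

Set Implicit Arguments.
Unset Strict Implicit.
Unset Printing Implicit Defensive.

Section MakerBreakerC4.

Variable n : nat.

Definition edge := {set 'I_n}.

Definition edges_K : {set edge} := [set e : edge | #|e| == 2].

(* The edge claimed by Maker, then the set of edges claimed by Breaker. *)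
Definition round := (edge * {set edge})%type.

(* Most recent round first. *)
Definition history := seq round.

Definition maker_edges (h : history) : {set edge} :=
  [set e | e \in map fst h].

Definition breaker_edges (h : history) : {set edge} :=
  \bigcup_(r <- h) r.2.

Definition free_edges (h : history) : {set edge} :=
  edges_K :\: (maker_edges h :|: breaker_edges h).

Definition has_C4 (M : {set edge}) : Prop :=
  exists a b c d : 'I_n, uniq [:: a; b; c; d] /\
    [/\ [set a; b] \in M, [set b; c] \in M, [set c; d] \in M
      & [set d; a] \in M].

(* The value is irrelevant once the board is full. *)
Definition maker_strategy (s : history -> edge) : Prop :=
  forall h : history, free_edges h != set0 -> s h \in free_edges h.

(* Histories that can occur when Maker, moving first in each round, follows s
   and Breaker claims at most q edges per round (possibly none). *)
Inductive play (q : nat) (s : history -> edge) : history -> Prop :=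
| play_start : play q s [::]
| play_round (h : history) (B : {set edge}) :
    play q s h ->
    free_edges h != set0 ->
    B \subset free_edges h :\ s h ->
    #|B| <= q ->
    play q s ((s h, B) :: h).

(* Every round consumes an edge, so every play extends to one with a full
   board, and a C4 owned by Maker at any time is still his at the end. *)
Definition maker_winning_strategy (q : nat) (s : history -> edge) : Prop :=
  maker_strategy s /\
  forall h : history, play q s h -> free_edges h = set0 ->
    has_C4 (maker_edges h).

Definition maker_wins_C4_game (q : nat) : Prop :=
  exists s : history -> edge, maker_winning_strategy q s.

End MakerBreakerC4.

(* Main.v *)
Require Import Defs.
From mathcomp Require Import all_boot boolp zify.

Set Implicit Arguments.
Unset Strict Implicit.
Unset Printing Implicit Defensive.

(** Maker wins by a purely deterministic strategy in three stages.  Put [D]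
    about [sqrt (2 * q)] and let [s] be half of [n]; since [c < 0.16], the
    number [D * q] is at most [n / 10].  This is the one place where the
    constant matters: while Maker spends [D] rounds at one vertex, Breaker
    can spoil at most a tenth of the pairs there.

    - Stage 1 ([force_star_system]).  Maker builds, one after another, [s]
      stars with [D] leaves each.  A new centre is a vertex whose Breaker
      degree is at most [3 * n / 10]; it exists because Breaker owns few edges
      in total, and then Breaker cannot stop the star.  Leaves are chosen so
      that no vertex is a leaf of more than [D] stars.  Hence the sum of the
      Breaker degrees over all leaves of all stars is at most [D] times the
      sum of all Breaker degrees, which is an average of at most [n / 5] per
      pair (centre, leaf).
    - Stage 2.  By Markov's inequality a fixed proportion of the stars is
      good: their leaves have average Breaker degree at most [3 * n / 8].
      Maker takes a vertex [u] of small Breaker degree and joins it to [D]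
      centres of good stars.  This gives [D * D >= 2 * q] paths [u - x - w].
    - Stage 3.  Averaging over the vertices [v] with [uv] still available
      yields one for which fewer than half of these paths have [vw] owned by
      Breaker.  Claiming [uv] then creates more than [q] simultaneous threats
      [vw].  They are different edges, since two paths that end in the same
      [w] already form a C4, so Breaker cannot answer all of them
      ([forces_C4_of_threats]).

    Strategies are handled through the inductive predicate [forces] on
    positions, which composes along stages ([forces_trans]) and is turned into
    an actual strategy only once ([forces_C4_wins]). *)

(** * Markov's inequality *)

Lemma card_markov (T : finType) (A : {set T}) (f : T -> nat) t :
  #|[set x in A | t <= f x]| * t <= \sum_(x in A) f x.
Proof.
rewrite -sum_nat_const [leqRHS](bigID [pred x | t <= f x]) /=.
apply: leq_trans (leq_addr _ _).
under eq_bigl do rewrite inE.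
by apply: leq_sum => x /andP[].
Qed.

(** * Forcing a position *)

Section Forcing.

Variables n q : nat.
Implicit Types (M B E F : {set edge n}) (e : edge n).

Definition open_edges M B := edges_K n :\: (M :|: B).

(** [forces P M B]: from a position with Maker's edges [M] and Breaker's edges
    [B], Maker to move, Maker can reach a position in [P] after finitely many
    rounds, whatever Breaker does. *)
Inductive forces (P : {set edge n} -> {set edge n} -> Prop) :
    {set edge n} -> {set edge n} -> Prop :=
| forces_now M B : P M B -> forces P M B
| forces_move M B e : e \in open_edges M B ->
    (forall F, F \subset open_edges M B :\ e -> #|F| <= q ->
       forces P (e |: M) (F :|: B)) ->
    forces P M B.

Lemma forces_trans (P Q : {set edge n} -> {set edge n} -> Prop) M B :
    forces P M B -> (forall M' B', P M' B' -> forces Q M' B') ->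
  forces Q M B.
Proof.
move=> fP PQ; elim: fP => {M B} [M B /PQ //|M B e eF _ IH].
exact: forces_move eF IH.
Qed.

Definition keeps_forcing P M B e : Prop :=
  e \in open_edges M B /\
  forall F, F \subset open_edges M B :\ e -> #|F| <= q -> forces P (e |: M) (F :|: B).

Lemma has_C4_mono M M' : M \subset M' -> has_C4 M -> has_C4 M'.
Proof.
move=> /subsetP sM [a [b [c [d [abcd [ab bc cd da]]]]]].
by exists a, b, c, d; split=> //; split; apply: sM.
Qed.

(** The strategy plays a move that keeps the win forced whenever there is one,
    and an arbitrary available edge otherwise.  A forced win then persists
    along every play, and on a full board it can only mean that Maker already
    owns a C4. *)
Lemma forces_C4_wins :
  forces (fun M _ => has_C4 M) set0 set0 -> maker_wins_C4_game n q.
Proof.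
set C4 := (fun M _ => has_C4 M) => f0.
pose s (h : history n) :=
  if [pick e | `[< keeps_forcing C4 (maker_edges h) (breaker_edges h) e >]]
    is Some e then e else odflt set0 [pick e in free_edges h].
exists s; split=> [h /set0Pn[e0 e0F]|h].
  rewrite /s; case: pickP => [e /asboolP[] //|_].
  by case: pickP => [//|/(_ e0)]; rewrite e0F.
have maker_cons e F h' : maker_edges ((e, F) :: h') = e |: maker_edges h'.
  by apply/setP=> e'; rewrite !inE.
have breaker_cons e F h' :
    breaker_edges ((e, F) :: h') = F :|: breaker_edges h'.
  by rewrite /breaker_edges big_cons.
move=> ph h_full.
have inv : forces C4 (maker_edges h) (breaker_edges h).
  elim: ph {h_full} => {h} [|h B _ IH _ subB leB].
    have -> : @maker_edges n [::] = set0 by apply/setP=> e; rewrite !inE.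
    by have -> : @breaker_edges n [::] = set0 by rewrite /breaker_edges big_nil.
  rewrite maker_cons breaker_cons; move: subB; rewrite /s.
  case: pickP => [e /asboolP[_ keepe] subB|no_e _]; first exact: keepe.
  case: IH no_e => [M B' C4M _|M B' e eF He /(_ e)/asboolP[]//].
  by apply/forces_now/(has_C4_mono _ C4M); apply: subsetUr.
have {}h_full : open_edges (maker_edges h) (breaker_edges h) = set0 by [].
by case: inv h_full => // M B e eF _ full; rewrite full inE in eF.
Qed.

(** * Neighbourhoods and stars *)

Definition nbrs E (x : 'I_n) := [set w | [set x; w] \in E].

Definition star (x : 'I_n) (T : {set 'I_n}) : {set edge n} :=
  [set [set x; w] | w in T].

Lemma set2_injr (x : 'I_n) : injective (fun w => [set x; w]).
Proof.
move=> w w' /= eqe.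
have : w \in [set x; w'] by rewrite -eqe !inE eqxx orbT.
have : w' \in [set x; w] by rewrite eqe !inE eqxx orbT.
by rewrite !inE => /orP[]/eqP-> /orP[]/eqP.
Qed.

Lemma nbrsU E F x : nbrs (E :|: F) x = nbrs E x :|: nbrs F x.
Proof. by apply/setP=> w; rewrite !inE. Qed.

Lemma card_nbrs_le E x : #|nbrs E x| <= #|E|.
Proof.
rewrite -(card_imset _ (@set2_injr x)) subset_leq_card //.
by apply/subsetP=> _ /imsetP[w + ->]; rewrite inE.
Qed.

(** Members of [E] with more than two elements are no pairs and contribute
    nothing, hence an inequality and no hypothesis on [E]. *)
Lemma sum_card_nbrs E : \sum_x #|nbrs E x| <= 2 * #|E|.
Proof.
have deg_le x : #|nbrs E x| <= \sum_(e in E | (x \in e) && (#|e| <= 2)) 1.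
  rewrite sum1dep_card -(card_imset _ (@set2_injr x)) subset_leq_card //.
  apply/subsetP=> _ /imsetP[w + ->]; rewrite !inE eqxx => -> /=.
  by rewrite cards2; case: eqP.
apply: (@leq_trans (\sum_x \sum_(e in E | (x \in e) && (#|e| <= 2)) 1)).
  by apply: leq_sum => x _; exact: deg_le.
rewrite (exchange_big_dep (mem E)) /=; last by move=> x e _ /andP[].
rewrite mulnC -sum_nat_const; apply: leq_sum => e eE.
rewrite eE /=; case: (leqP #|e| 2) => [le2|_].
  by under eq_bigl => x do rewrite andbT; rewrite sum1_card.
by rewrite big1 // => x; rewrite andbF.
Qed.

Lemma open_set2 M B x w :
  ([set x; w] \in open_edges M B) = (x != w) && (w \notin nbrs (M :|: B) x).
Proof.
by rewrite !inE cards2 andbC; case: (x != w).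
Qed.

(** Each round at [x] removes at most [q + 1] candidates from [C]: the leaf that
    Maker takes and at most [q] pairs claimed by Breaker. *)
Lemma force_star k M B x (C : {set 'I_n}) :
    x \notin C -> #|C :&: nbrs (M :|: B) x| + k * q.+1 <= #|C| ->
  forces (fun M' B' => exists (T : {set 'I_n}) F,
      [/\ T \subset C, #|T| = k, [disjoint T & nbrs (M :|: B) x],
          #|F| <= k * q & M' = star x T :|: M /\ B' = F :|: B]) M B.
Proof.
move=> xC; elim: k M B => [|k IH] M B leC.
  apply: forces_now; exists set0, set0.
  by rewrite sub0set !cards0 disjoints_subset sub0set /star imset0 !set0U.
have /set0Pn[w] : C :\: nbrs (M :|: B) x != set0.
  by rewrite -card_gt0 cardsD; lia.
rewrite inE => /andP[wN wC].
have xw : x != w by apply: contraNneq xC => ->.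
apply: (forces_move (e := [set x; w])); first by rewrite open_set2 xw.
move=> F _ leF.
have nbrs_next : nbrs (([set x; w] |: M) :|: (F :|: B)) x
    = w |: (nbrs F x :|: nbrs (M :|: B) x).
  apply/setP=> v; rewrite !inE (inj_eq (@set2_injr x)).
  by rewrite -orbA; congr (_ || _); exact: orbCA.
apply: forces_trans (IH ([set x; w] |: M) (F :|: B) _) _.
  rewrite nbrs_next.
  apply: leq_trans leC; rewrite mulSn addnA leq_add2r addnC.
  have : #|C :&: (w |: (nbrs F x :|: nbrs (M :|: B) x))| <=
         #|w |: (nbrs F x :|: (C :&: nbrs (M :|: B) x))|.
    apply/subset_leq_card/subsetP=> v; rewrite !inE.
    by case: (v \in C) => //=; rewrite ?orbF //.
  move/leq_trans; apply.
  rewrite cardsU1 -add1n -addnA; apply: leq_add; first by case: (_ \notin _).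
  apply: leq_trans (leq_card_setU _ _) _; rewrite leq_add2r.
  exact: leq_trans (card_nbrs_le F x) leF.
move=> _ _ [T [G [TC cardT disT leG [-> ->]]]].
have wT : w \notin T.
  by apply: contraTN disT => wT; apply/pred0Pn; exists w;
    rewrite /= wT nbrs_next !inE eqxx.
apply: forces_now; exists (w |: T), (G :|: F); split.
- by rewrite subUset sub1set wC.
- by rewrite cardsU1 wT cardT.
- move: disT; rewrite nbrs_next !disjoints_subset subUset sub1set inE wN /=.
  by move/subset_trans; apply; rewrite setCS setUA subsetUr.
- by apply: leq_trans (leq_card_setU _ _) _; lia.
- by rewrite /star imsetU1 -!setUA [in RHS]setUCA.
Qed.

(** * Creating too many threats at once *)

(** The pairs in [O] are the middle edges of paths [u - p.1 - p.2 - v] missing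
    only [uv].  Either two of them have the same [p.2], which is a C4 through
    [u], or the closing pairs [{p.2, v}] are distinct and outnumber Breaker's
    next move. *)
Lemma forces_C4_of_threats M B u v (O : {set 'I_n * 'I_n}) :
    [set u; v] \in open_edges M B ->
    (forall p, p \in O -> [/\ uniq [:: u; p.1; p.2; v], [set u; p.1] \in M,
       [set p.1; p.2] \in M & [set p.2; v] \notin B]) ->
    q < #|O| ->
  forces (fun M' _ => has_C4 M') M B.
Proof.
move=> uvF O_path gtO.
have [[x [w [w' [y C4M]]]]|noC4] := pselect (has_C4 M).
  by apply: forces_now; exists x, w, w', y.
have snd_inj : {in O &, injective snd}.
  move=> [x w] [x' w'] /= p_O p'_O eqw; rewrite -{w'}eqw in p'_O *.
  have [/= uxwv ux xw _] := O_path _ p_O; have [/= ux'wv ux' x'w _] := O_path _ p'_O.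
  case: (eqVneq x x') => [->//|xx']; case: noC4; exists u, x, w, x'; split.
    move: uxwv ux'wv xx'; rewrite /= !inE !negb_or !andbT.
    do 2 (case/and3P=> /and3P[? ? ?] /andP[? ?] ?); move=> ?.
    by apply/and3P; split; [apply/and3P; split | apply/andP; split | rewrite eq_sym].
  by split; rewrite // setUC.
apply: (forces_move uvF) => F _ leF.
pose closings := [set [set p.2; v] | p in O].
have card_closings : #|closings| = #|O|.
  rewrite card_in_imset // => p p' pO p'O /=; rewrite ![[set _; v]]setUC.
  by move/set2_injr; apply: snd_inj.
have /set0Pn[e] : closings :\: F != set0.
  rewrite -card_gt0 cardsD subn_gt0 card_closings.
  by apply: leq_ltn_trans (leq_ltn_trans leF gtO); rewrite subset_leq_card ?subsetIr.
rewrite inE => /andP[eF /imsetP[[x w] /= pO def_e]].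
have [/= uxwv ux xw wvB] := O_path _ pO.
have C4_closed : has_C4 (e |: ([set u; v] |: M)).
  exists u, x, w, v; split=> //; rewrite -def_e [[set v; u]]setUC !inE !eqxx ux xw.
  by rewrite !orbT.
have [eM|eM] := boolP (e \in [set u; v] |: M).
  by apply/forces_now/(has_C4_mono _ C4_closed); rewrite subUset sub1set eM /=.
apply: (forces_move (e := e)) => [|G _ _]; last exact: forces_now.
rewrite in_setD in_setU negb_or eM in_setU negb_or eF def_e wvB inE cards2 /=.
by move: uxwv; rewrite /= !inE => /and3P[_ _]; rewrite andbT => ->.
Qed.

(** * Systems of stars *)

Definition system_edges (S : 'I_n -> {set 'I_n}) : {set edge n} :=
  \bigcup_x star x (S x).

(** [S x] is the set of leaves of the star with centre [x], for [x] in [X].  The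
    last clause, a cap on the number of stars through a leaf, lets sums over
    pairs (centre, leaf) be compared with sums over vertices. *)
Definition star_system D (X : {set 'I_n}) (S : 'I_n -> {set 'I_n}) : Prop :=
  [/\ forall x, x \in X -> #|S x| = D, forall x, x \notin X -> S x = set0,
      forall x, x \notin S x & forall w, #|[set x | w \in S x]| <= D].

Lemma mem_system_edges S x w :
  ([set x; w] \in system_edges S) = (w \in S x) || (x \in S w).
Proof.
apply/bigcupP/orP => [[y _ /imsetP[z zS eq_e]]|[wS|xS]]; last 2 first.
- by exists x => //; apply: imset_f.
- by exists w => //; rewrite setUC; apply: imset_f.
have : y \in [set x; w] by rewrite eq_e !inE eqxx.
rewrite !inE => /orP[]/eqP eqy; rewrite eqy in eq_e zS.
  by move/set2_injr: eq_e zS => ->; left.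
by rewrite setUC in eq_e; move/set2_injr: eq_e zS => ->; right.
Qed.

Lemma card_star_le D X S x : star_system D X S -> #|S x| <= D.
Proof.
by case=> cardS S0 _ _; have [/cardS->|/S0->] := boolP (x \in X); rewrite ?cards0.
Qed.

Lemma card_nbrs_system D X S x : star_system D X S ->
  #|nbrs (system_edges S) x| <= 2 * D.
Proof.
move=> sysS; have [_ _ _ multS] := sysS.
have -> : nbrs (system_edges S) x = S x :|: [set y | x \in S y].
  by apply/setP=> w; rewrite !inE mem_system_edges.
apply: leq_trans (leq_card_setU _ _) _; rewrite mul2n -addnn.
exact: leq_add (card_star_le _ sysS) (multS x).
Qed.

Lemma sum_leaves_le D X S (A : {set 'I_n}) (f : 'I_n -> nat) :
    star_system D X S ->
  \sum_(x in A) \sum_(w in S x) f w <= D * \sum_w f w.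
Proof.
case=> _ _ _ multS.
rewrite (exchange_big_dep predT) //= big_distrr /=; apply: leq_sum => w _.
rewrite sum_nat_const leq_mul2r; apply/orP; right.
apply: leq_trans (multS w); apply/subset_leq_card/subsetP=> x.
by rewrite !inE => /andP[].
Qed.

(** Double counting of the [D * #|X|] pairs (centre, leaf).  It leaves all but
    [#|X|] vertices available as leaves of a new star. *)
Lemma card_saturated D X S : 0 < D -> star_system D X S ->
  #|[set w | D <= #|[set x | w \in S x]|]| <= #|X|.
Proof.
move=> D_gt0 [cardS S0 _ _]; rewrite -(leq_pmul2r D_gt0) -!sum_nat_const.
have -> : \sum_(x in X) D = \sum_x #|S x|.
  rewrite [RHS](bigID (mem X)) /= [X in _ = _ + X]big1 ?addn0.
    by apply: eq_bigr => x /cardS.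
  by move=> x /S0 ->; rewrite cards0.
have -> : \sum_x #|S x| = \sum_w #|[set x | w \in S x]|.
  under eq_bigr do rewrite -sum1_card.
  rewrite (exchange_big_dep predT) //=; apply: eq_bigr => w _.
  by rewrite -sum1_card; apply: eq_bigl => x; rewrite inE.
have := card_markov [set: 'I_n] (fun w => #|[set x | w \in S x]|) D.
rewrite sum_nat_const; under eq_finset do rewrite in_setT.
by under eq_bigl do rewrite in_setT.
Qed.

End Forcing.

(** * The three stages *)

Section Strategy.

Variables n q D s : nat.
Hypotheses (q_large : 1000 <= q) (D_large : 2 * q <= D * D)
  (Dq_small : 10 * (D * q) <= n).

Lemma D_ge : 44 <= D.
Proof.
rewrite leqNgt; apply/negP=> ltD; have := leq_mul ltD ltD.
lia.
Qed.

Lemma n_ge_q : 440 * q <= n.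
Proof. by apply: leq_trans Dq_small; have := leq_mul D_ge (leqnn q); lia. Qed.

Lemma n_ge_D : 1000 * D <= n.
Proof. by apply: leq_trans Dq_small; have := leq_mul (leqnn D) q_large; lia. Qed.

Lemma star_system_add X (S : 'I_n -> {set 'I_n}) x (T : {set 'I_n}) :
    star_system D X S -> x \notin X -> x \notin T -> #|T| = D ->
    (forall w, w \in T -> #|[set y | w \in S y]| < D) ->
  let S' := fun y => if y == x then T else S y in
  star_system D (x |: X) S' /\ system_edges S' = star x T :|: system_edges S.
Proof.
move=> [cardS S0 irrS multS] xX xT cardT multT S'; split.
  split=> [y|y|y|w]; rewrite /S'.
  - by rewrite !inE; case: eqP => //= _ /cardS.
  - by rewrite !inE; case: eqP => //= _ /S0.
  - by case: eqP => [->|].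
  have sub_w : [set y | w \in if y == x then T else S y]
      \subset (if w \in T then [set x] else set0) :|: [set y | w \in S y].
    apply/subsetP=> y; rewrite !inE; case: eqP => [-> ->|_ ->]; last by rewrite orbT.
    by rewrite !inE eqxx.
  apply: leq_trans (subset_leq_card sub_w) _.
  case: ifP => [wT|_]; last by rewrite set0U.
  rewrite cardsU1; apply: leq_trans (leq_add (leq_b1 _) (leqnn _)) _.
  by rewrite add1n multT.
rewrite /system_edges (bigD1 x) //= [in RHS](bigD1 x) //= /S' eqxx (S0 _ xX).
rewrite [star x set0]imset0 set0U; congr (_ :|: _).
by apply: eq_bigr => y /negbTE ->.
Qed.

(** After [j <= n / 2] stars Breaker owns at most [j * n / 10] edges, so at most
    [2 * j / 3] vertices have Breaker degree [3 * n / 10] or more, and some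
    vertex is neither one of these nor a centre.  Around it at least [n / 2]
    vertices may serve as leaves; [3 * n / 10] are lost to Breaker before the
    star is begun and [n / 10] while it is built. *)
Lemma force_star_system j : 2 * j <= n ->
  forces q (fun M B => exists (X : {set 'I_n}) S,
     [/\ #|X| = j, star_system D X S, M = system_edges S & #|B| <= j * (D * q)])
   set0 set0.
Proof.
have Dn := n_ge_D; have Dge := D_ge.
elim: j => [|j IH] lej.
  apply: forces_now; exists set0, (fun=> set0); rewrite !cards0; split=> //.
    split=> [x|//|x|w]; rewrite ?inE //.
    by rewrite eq_card0 // => x; rewrite !inE.
  rewrite /system_edges big1 // => x _; exact: imset0.
apply: forces_trans (IH _) _ => [|M B [X [S [cardX sysS defM leB]]]]; first lia.
(* the vertices at which Breaker is too strong for a new star *)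
pose L := [set x in setT | 3 * n <= 10 * #|nbrs B x|].
have leL : 3 * #|L| <= 2 * j.
  have : #|L| * (3 * n) <= 10 * (2 * #|B|).
    apply: leq_trans (card_markov _ _ _) _.
    by rewrite -big_distrr /= leq_mul2l (leq_trans _ (sum_card_nbrs B)) //
       (eq_bigl _ _ (@in_setT _)).
  move=> h; rewrite -(leq_pmul2r (_ : 0 < n)); last lia.
  have := leq_mul (leqnn j) Dq_small; move: h leB.
  move: (#|L|) (#|B|) => l b; move: (D * q) => p *.
  nia.
have /set0Pn[x] : ~: (X :|: L) != set0.
  rewrite -card_gt0 cardsCs setCK card_ord subn_gt0.
  apply: leq_ltn_trans (leq_card_setU _ _) _; rewrite cardX.
  by move: leL; move: (#|L|) => l; lia.
rewrite !inE negb_or /= -ltnNge => /andP[xX xL].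
pose sat := [set w | D <= #|[set y | w \in S y]|].
have le_sat : #|sat| <= j by rewrite -cardX; apply: card_saturated sysS; lia.
pose C := ~: (x |: sat).
apply: forces_trans (force_star (k := D) (x := x) (C := C) _ _) _.
- by rewrite !inE eqxx.
- have : #|C :&: nbrs (M :|: B) x| <= 2 * D + #|nbrs B x|.
    apply: leq_trans (subset_leq_card (subsetIr _ _)) _; rewrite nbrsU.
    apply: leq_trans (leq_card_setU _ _) _; rewrite leq_add2r defM.
    exact: card_nbrs_system sysS.
  have : n <= #|C| + j.+1.
    rewrite -[leqLHS](card_ord n) -(cardsC (x |: sat)) addnC leq_add2l.
    by rewrite cardsU1 -add1n leq_add ?leq_b1.
  move: xL; rewrite mulnS; move: Dq_small; move: (D * q) => p.
  move: (#|C|) (#|C :&: _|) (#|nbrs B x|) => *; lia.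
move=> _ _ [T [F [TC cardT _ leF [-> ->]]]].
have xT : x \notin T.
  by apply/negP=> /(subsetP TC); rewrite !inE eqxx.
have multT w : w \in T -> #|[set y | w \in S y]| < D.
  by move/(subsetP TC); rewrite !inE negb_or -ltnNge => /andP[].
have [sysS' edgesS'] := star_system_add sysS xX xT cardT multT.
apply: forces_now; exists (x |: X); eexists; split.
- by rewrite cardsU1 xX cardX.
- exact: sysS'.
- by rewrite edgesS' defM.
by apply: leq_trans (leq_card_setU _ _) _; rewrite mulSn; apply: leq_add.
Qed.

Hypotheses (le_s : 2 * s <= n) (ge_s : n <= 2 * s + 1).

(** Stages 2 and 3.  Good stars number at least [7 * s / 15].  Joining [u] to [D]
    of their centres costs about [s / 5 + n / 10], which is less.  About
    [8 * n / 10] vertices [v] remain available at [u]; if each had at least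
    half of the [D * D] paths blocked, the blocked pairs (path, [v]) would
    number about [4 * n / 10 * D * D], against the [3 * n / 8 * D * D] that good
    stars allow. *)
Lemma forces_C4 : forces q (fun M _ => @has_C4 n M) set0 set0.
Proof.
have Dn := n_ge_D; have Dge := D_ge; have qn := n_ge_q.
apply: forces_trans (force_star_system le_s) _.
move=> M B [X [S [cardX sysS defM leB]]].
have [cardS _ irrS _] := sysS.
pose load x := \sum_(w in S x) #|nbrs B w|.
pose bad := [set x in X | 3 * (n * D) <= 8 * load x].
have le_bad : 15 * #|bad| <= 8 * s.
  have le_load : \sum_(x in X) load x <= D * (2 * #|B|).
    apply: leq_trans (sum_leaves_le X _ sysS) _.
    by rewrite leq_mul2l sum_card_nbrs orbT.
  have : #|bad| * (3 * (n * D)) <= 8 * (D * (2 * (s * (D * q)))).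
    apply: leq_trans (card_markov _ _ _) _.
    rewrite -big_distrr /= leq_mul2l (leq_trans le_load) //.
    by rewrite leq_mul2l (leq_mul2l 2) leB !orbT.
  move=> h; have nD_gt0 : 0 < n * D by rewrite muln_gt0; lia.
  rewrite -(leq_pmul2r nD_gt0).
  have := leq_mul (leqnn (D * s)) Dq_small; move: h.
  move: (#|bad|) => b; move: (D * q) => p *; nia.
have [u le_u] : exists u, 5 * #|nbrs B u| <= s.
  apply: contrapT => no_u.
  have : n * s.+1 <= 5 * (2 * (s * (D * q))).
    apply: leq_trans (_ : 5 * \sum_x #|nbrs B x| <= _); last first.
      by rewrite leq_mul2l (leq_trans (sum_card_nbrs B)) // leq_mul2l leB orbT.
    rewrite -[X in X * _](card_ord n) -sum_nat_const big_distrr /=.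
    by apply: leq_sum => x _; rewrite ltnNge; apply/negP=> le_x; case: no_u; exists x.
  have := leq_mul (leqnn s) Dq_small; move: (D * q) => p; nia.
(* second stage: join [u] to the centres of [D] good stars *)
pose good := X :\: bad; pose C := good :\ u.
apply: forces_trans (force_star (k := D) (x := u) (C := C) _ _) _.
- by rewrite !inE eqxx.
- have : #|C :&: nbrs (M :|: B) u| <= 2 * D + #|nbrs B u|.
    apply: leq_trans (subset_leq_card (subsetIr _ _)) _; rewrite nbrsU.
    apply: leq_trans (leq_card_setU _ _) _; rewrite leq_add2r defM.
    exact: card_nbrs_system sysS.
  have : s <= #|C| + #|bad| + 1.
    rewrite -cardX -(cardsID bad X) addnC -addnA [_ + 1]addnC addnA.
    apply: leq_add; last by rewrite subset_leq_card // subsetIr.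
    by rewrite (cardsD1 u (X :\: bad)) addnC leq_add2l leq_b1.
  move: le_bad le_u; rewrite mulnS; move: Dq_small; move: (D * q) => p.
  move: (#|C|) (#|C :&: _|) (#|nbrs B u|) (#|bad|) => *; lia.
move=> _ _ [T [F [TC cardT disT leF [-> ->]]]].
set M' := _ :|: M; set B' := F :|: B.
have T_good x : x \in T -> [/\ x \in X, x != u, 8 * load x <= 3 * (n * D)
    & [set u; x] \notin M].
  move=> xT; have := subsetP TC x xT; rewrite !inE => /and3P[xu].
  case xX: (x \in X) => //=; rewrite -ltnNge => /ltnW lex _; split=> //.
  have := disjointFr disT xT; rewrite inE inE => /negbT; rewrite negb_or.
  by case/andP.
(* third stage: the pairs [p] in [P] stand for the paths [u - p.1 - p.2] *)
pose P := [set p | (p.1 \in T) && (p.2 \in S p.1)].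
have sumP (f : 'I_n -> nat) :
    \sum_(p in P) f p.2 = \sum_(x in T) \sum_(w in S x) f w.
  by rewrite pair_big_dep /=; apply: eq_bigl => p; rewrite inE.
have cardP : #|P| = D * D.
  rewrite -sum1_card (sumP (fun=> 1)) -{1}cardT -sum_nat_const.
  by apply: eq_bigr => x /T_good[/cardS <-]; rewrite sum1_card.
(* the paths that [v] cannot close, because Breaker owns the closing edge or
   because [v] is on the path *)
pose blocked v := [set p in P | (v \in nbrs B' p.2) || (v == p.2)].
have sum_blocked : 8 * \sum_v #|blocked v| <= (D * D) * (3 * n + 16 * q + 8).
  have swap : \sum_v #|blocked v|
      <= \sum_(p in P) (#|nbrs F p.2| + #|nbrs B p.2| + 1).
    under eq_bigr do rewrite -sum1dep_card.
    rewrite (exchange_big_dep (mem P)) /=; last by move=> v p _ /andP[].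
    apply: leq_sum => p pP; rewrite pP /= sum1dep_card.
    apply: leq_trans (_ : #|nbrs B' p.2 :|: [set p.2]| <= _).
      by apply/subset_leq_card/subsetP=> v; rewrite !inE.
    apply: leq_trans (leq_card_setU _ _) _; rewrite cards1 leq_add2r nbrsU.
    exact: leq_card_setU.
  (* Breaker's answers during the second stage: they may all be aimed at the
     leaves, but the cap on stars through a leaf makes them negligible *)
  have loadF : \sum_(p in P) #|nbrs F p.2| <= D * (2 * (D * q)).
    rewrite (sumP (fun w => #|nbrs F w|)).
    apply: leq_trans (sum_leaves_le T _ sysS) _; rewrite leq_mul2l.
    by rewrite (leq_trans (sum_card_nbrs F)) ?orbT // leq_mul2l leF orbT.
  have loadB : 8 * (\sum_(p in P) #|nbrs B p.2|) <= D * (3 * (n * D)).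
    rewrite (sumP (fun w => #|nbrs B w|)) big_distrr /= -cardT -sum_nat_const cardT.
    by apply: leq_sum => x /T_good[].
  move: swap; rewrite !big_split /= sum1_card cardP.
  move: loadF loadB.
  move: (\sum_v _) (\sum_(p in P) #|nbrs F p.2|) (\sum_(p in P) #|nbrs B p.2|) => *; lia.
pose A := [set v | [set u; v] \in open_edges M' B'].
have le_A : n <= #|A| + 1 + 3 * D + D * q + #|nbrs B u|.
  have subA : ~: A \subset
      u |: (nbrs (star u T) u :|: nbrs M u :|: (nbrs F u :|: nbrs B u)).
    apply/subsetP=> v; rewrite in_setC in_set open_set2 negb_and !negbK -!nbrsU.
    by rewrite in_setU1 eq_sym.
  have cardA : #|u |: (nbrs (star u T) u :|: nbrs M u :|: (nbrs F u :|: nbrs B u))|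
      <= 1 + (D + 2 * D + (D * q + #|nbrs B u|)).
    rewrite cardsU1; apply: leq_add (leq_b1 _) _.
    apply: leq_trans (leq_card_setU _ _) (leq_add _ _).
      apply: leq_trans (leq_card_setU _ _) (leq_add _ _).
        by rewrite (leq_trans (card_nbrs_le _ _)) //
           (leq_trans (leq_imset_card _ _)) ?cardT.
      by rewrite defM; apply: card_nbrs_system sysS.
    apply: leq_trans (leq_card_setU _ _) (leq_add _ (leqnn _)).
    exact: leq_trans (card_nbrs_le _ _) leF.
  have := leq_trans (subset_leq_card subA) cardA; have := cardsC A.
  rewrite card_ord; move: (#|A|) (#|~: A|) (#|nbrs B u|) (D * q) => *; lia.
have [v uvF lt_v] : exists2 v, v \in A & 2 * #|blocked v| < D * D.
  apply: contrapT => no_v.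
  have : #|A| * (D * D) <= 2 * \sum_v #|blocked v|.
    rewrite -sum_nat_const big_distrr /= [leqRHS](bigID (mem A)) /=.
    apply: leq_trans (leq_addr _ _); apply: leq_sum => v vA.
    by rewrite leqNgt; apply/negP=> lt_v; case: no_v; exists v.
  move=> le1; have: 4 * #|A| <= 3 * n + 16 * q + 8.
    have DD_gt0 : 0 < D * D by rewrite muln_gt0; lia.
    rewrite -(leq_pmul2l DD_gt0); move: sum_blocked le1.
    move: (\sum_v _) (#|A|) (D * D) => *; lia.
  move: le_A le_u Dq_small; move: (#|A|) (#|nbrs B u|) (D * q) => *; lia.
rewrite inE in uvF.
apply: (forces_C4_of_threats (O := P :\: blocked v) uvF).
  move=> p /setDP[pP]; rewrite in_set pP /= negb_or => /andP[vB' p2v].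
  move: pP; rewrite in_set => /andP[pT pS].
  have [_ pu _ upM] := T_good _ pT.
  have upM' : [set u; p.1] \in M'.
    by rewrite in_setU; apply/orP; left; apply: imset_f.
  have pM : [set p.1; p.2] \in M by rewrite defM mem_system_edges pS.
  move: uvF; rewrite open_set2 nbrsU in_setU negb_or => /and3P[uv uvM' _].
  split=> //; last 2 first.
  - by rewrite in_setU pM orbT.
  - by rewrite in_set in vB'.
  rewrite /= !inE !negb_or uv [u == p.1]eq_sym pu [p.2 == v]eq_sym p2v /= !andbT.
  apply/and3P; split.
  - by apply: contraNneq upM => def_u; rewrite [in [set u; _]]def_u setUC.
  - by apply: contraTneq pS => <-; apply: irrS.
  - by apply: contraNneq uvM' => <-; rewrite in_set.
rewrite cardsD (setIidPr _); last by apply/subsetP=> p; rewrite inE => /andP[].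
rewrite cardP; move: lt_v D_large; move: (#|_|) (D * D) => *; lia.
Qed.

End Strategy.

(** * From the cubic bound to the strategy *)

Lemma maker_wins_C4_mono n q q' :
  q <= q' -> maker_wins_C4_game n q' -> maker_wins_C4_game n q.
Proof.
move=> leqq' [s [s_legal s_wins]]; exists s; split=> // h play_h.
apply: s_wins; elim: play_h => [|{}h B _ IH hF subB leB]; first exact: play_start.
exact: play_round IH hF subB (leq_trans leB leqq').
Qed.

(** [D] is the least number with [2 * q <= D * D]; rounding it up costs a factor of
    at most [21 / 20] in [D * D] once [q >= 1000], so [100 * (D * q) ^ 2] is at most
    [210 * q ^ 3]. *)
Lemma maker_wins_C4_cube n q :
  1000 <= q -> 225 * q ^ 3 <= n ^ 2 -> maker_wins_C4_game n q.
Proof.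
move=> q_large cube_le.
have exD : exists D, 2 * q <= D * D by exists (2 * q); nia.
case: (ex_minnP exD) => D D_large D_min.
have Dge := D_ge q_large D_large.
have lt_pred : D.-1 * D.-1 < 2 * q.
  by rewrite ltnNge; apply/negP=> /D_min; lia.
have D_small : 10 * (D * D) <= 21 * q.
  case: D Dge lt_pred {D_large D_min} => //= D; nia.
have Dq_small : 10 * (D * q) <= n.
  rewrite -leq_sqr; apply: leq_trans cube_le.
  have := leq_mul D_small (leqnn (10 * (q * q))).
  by rewrite !expnS !expn0 !muln1; nia.
apply: forces_C4_wins; apply: (forces_C4 (D := D) (s := n./2)) => //; lia.
Qed.

(** * The real bound *)

From HB Require Import structures.
From mathcomp Require Import all_order all_algebra.
From mathcomp Require Import all_classical all_reals all_analysis.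
From mathcomp Require Import lra.

Import Order.TTheory GRing.Theory Num.Theory.
Local Open Scope ring_scope.

(** Here [0.16 ^ 3 * 225 = 0.9216 <= 1]. *)
Lemma cube_truncn_le (R : realType) (c : R) (n : nat) : c < 16 / 100 ->
  (225 * Num.truncn (c * n%:R `^ (2 / 3)) ^ 3 <= n ^ 2)%N.
Proof.
move=> hc; set x : R := n%:R `^ (2 / 3).
have x_ge0 : 0 <= x := powR_ge0 _ _.
have x3 : x ^+ 3 = n%:R ^+ 2.
  rewrite -!powR_mulrn ?ler0n // -powRrM.
  by rewrite divfK // pnatr_eq0.
have le_x : (Num.truncn (c * x))%:R <= 16 / 100 * x.
  apply: (@le_trans _ _ (Num.truncn (16 / 100 * x))%:R).
    by rewrite ler_nat le_truncn // ler_wpM2r // ltW.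
  by rewrite truncn_le mulr_ge0.
rewrite -(ler_nat R) natrM !natrX -x3.
apply: le_trans (_ : 225 * (16 / 100 * x) ^+ 3 <= _).
  by rewrite ler_wpM2l ?ler0n // lerXn2r ?nnegrE ?ler0n ?(le_trans _ le_x) ?ler0n.
have : 0 <= x ^+ 3 by rewrite exprn_ge0.
rewrite exprMn; lra.
Qed.

Theorem theorem2p3 (R : realType) (c : R) (hc : c < 16 / 100) :
  exists N : nat, forall n : nat, (N <= n)%N ->
    maker_wins_C4_game n (Num.truncn (c * n%:R `^ (2 / 3))).
Proof.
have [N cube_N] : exists N, (225 * 1000 ^ 3 <= N)%N by eexists; apply: leqnn.
exists N => n leNn.
(* a small bias is raised to 1000, which makes rounding errors harmless *)
apply: (maker_wins_C4_mono (leq_maxr 1000 _)).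
apply: maker_wins_C4_cube; first exact: leq_maxl.
have [_|_] := leqP 1000 (Num.truncn (c * n%:R `^ (2 / 3))).
  exact: cube_truncn_le.
apply: leq_trans (leq_trans cube_N leNn) _.
by rewrite -mulnn; case: (n) => // m; rewrite leq_pmulr.
Qed.
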